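(* For any $\bar P_0\in\mathcal{W}(\mathcal{X},\mathcal{D})$ and $P_\odot\in\mathcal{W}_\kappa(\mathcal{Y},\mathcal{E})$, let $$\mathcal{L}(\bar P_0)=\{P\in\mathcal{W}_\kappa(\mathcal{Y},\mathcal{E})\colon\kappa_\star P=\bar P_0\},\qquad \mathcal{J}(P_\odot)=\{\Lambda^{(P_\odot)}_\star\bar P\colon\bar P\in\mathcal{W}(\mathcal{X},\mathcal{D})\}.$$ Then: (i) $\mathcal{J}(P_\odot)$ forms an e-family in $\mathcal{W}(\mathcal{Y},\mathcal{E})$, with $\dim\mathcal{J}(P_\odot)=|\mathcal{D}|-|\mathcal{X}|$. (ii) $\mathcal{L}(\bar P_0)$ forms an m-family in $\mathcal{W}(\mathcal{Y},\mathcal{E})$, with $\dim\mathcal{L}(\bar P_0)=|\mathcal{E}|-\sum_{(x,x')\in\mathcal{D}}|\mathcal{S}_x|$.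
   Context: All vertex sets are finite with at least two elements. $(\mathcal{Y},\mathcal{E})$ is a strongly connected digraph and $\kappa\colon\mathcal{Y}\to\mathcal{X}$ is a surjective map (lumping function); $\mathcal{S}_x=\kappa^{-1}(\{x\})$, $\mathcal{D}=\{(\kappa(y),\kappa(y')):(y,y')\in\mathcal{E}\}$; it is assumed that $\mathcal{W}_\kappa(\mathcal{Y},\mathcal{E})\ne\emptyset$. $\mathcal{F}(\mathcal{Y},\mathcal{E})$ is the space of real functions on $\mathcal{Y}^2$ vanishing outside $\mathcal{E}$, $\mathcal{F}_+(\mathcal{Y},\mathcal{E})$ the subset of those strictly positive on $\mathcal{E}$, and $\mathcal{W}(\mathcal{Y},\mathcal{E})$ the set of $P\in\mathcal{F}_+(\mathcal{Y},\mathcal{E})$ whose rows sum to $1$ (similarly for $(\mathcal{X},\mathcal{D})$). $P\in\mathcal{W}(\mathcal{Y},\mathcal{E})$ has stationary distribution $\pi$ and edge measure $Q(y,y')=\pi(y)P(y,y')$. $P\in\mathcal{W}(\mathcal{Y},\mathcal{E})$ is $\kappa$-lumpable if $\sum_{y'\in\mathcal{S}_{x'}}P(y_1,y')=\sum_{y'\in\mathcal{S}_{x'}}P(y_2,y')$ for all $x,x'\in\mathcal{X}$, $y_1,y_2\in\mathcal{S}_x$; the common value is $\kappa_\star P(x,x')$, and $\kappa_\star P\in\mathcal{W}(\mathcal{X},\mathcal{D})$. $\mathcal{W}_\kappa(\mathcal{Y},\mathcal{E})$ is the set of $\kappa$-lumpable elements. Canonical embedding: for $P_\odot\in\mathcal{W}_\kappa(\mathcal{Y},\mathcal{E})$,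 $\Lambda^{(P_\odot)}_\star\bar P(y,y')=\bar P(\kappa(y),\kappa(y'))\,\frac{P_\odot(y,y')}{\kappa_\star P_\odot(\kappa(y),\kappa(y'))}$ for $(y,y')\in\mathcal{E}$, and $0$ otherwise. e-family of dimension $d$ in $\mathcal{W}(\mathcal{Y},\mathcal{E})$: a family $\{P_\theta:\theta\in\mathbb{R}^d\}\subset\mathcal{W}(\mathcal{Y},\mathcal{E})$ for which there exist $K,g_1,\dots,g_d\in\mathcal{F}(\mathcal{Y},\mathcal{E})$ and functions $R\colon\mathbb{R}^d\times\mathcal{Y}\to\mathbb{R}$, $\psi\colon\mathbb{R}^d\to\mathbb{R}$ with $\log P_\theta(y,y')=K(y,y')+\sum_{i=1}^d\theta^ig_i(y,y')+R(\theta,y')-R(\theta,y)-\psi(\theta)$ for all $(y,y')\in\mathcal{E}$, $\theta\in\mathbb{R}^d$, where $g_1,\dots,g_d$ are linearly independent modulo the subspace $\mathcal{N}(\mathcal{Y},\mathcal{E})$ of functions of the form $(y,y')\mapsto f(y')-f(y)+c$ on $\mathcal{E}$ ($f\in\mathbb{R}^{\mathcal{Y}}$, $c\in\mathbb{R}$). m-family of dimension $d$ in $\mathcal{W}(\mathcal{Y},\mathcal{E})$: a family for which there exist $C,F_1,\dots,F_d\in\mathcal{F}(\mathcal{Y},\mathcal{E})$ with $C,C+F_1,\dots,C+F_d$ affinely independent, $\sum_{\mathcal{E}}C=1$, $\sum_{\mathcal{E}}F_i=0$, such that the family equals $\{P_\xi\in\mathcal{W}(\mathcal{Y},\mathcal{E}):Q_\xi=C+\sum_{i=1}^d\xi^iF_i,\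 \xi\in\Xi\}$, where $\Xi=\{\xi\in\mathbb{R}^d:Q_\xi(y,y')>0\ \forall(y,y')\in\mathcal{E}\}$ and $Q_\xi$ is the edge measure of $P_\xi$. *)

(* Defs.v *)
From mathcomp Require Import all_boot all_order all_algebra.
From mathcomp Require Import classical_sets reals exp.

Set Implicit Arguments.
Unset Strict Implicit.
Unset Printing Implicit Defensive.

Import Order.TTheory GRing.Theory Num.Theory.

Local Open Scope classical_set_scope.
Local Open Scope ring_scope.

(* A digraph with vertex set Y is given by its edge set E : {set Y * Y}
   (self-loops allowed); real functions on Y^2 are elements of
   {ffun Y * Y -> R}, evaluated at pairs (y, y'). *)

Definition strongly_connected (Y : finType) (E : {set Y * Y}) : Prop :=
  forall y y' : Y, connect (fun u v => (u, v) \in E) y y'.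

Section EdgeFunctions.
Variables (R : realType) (Y : finType) (E : {set Y * Y}).

Definition F_space : set {ffun Y * Y -> R} :=
  [set h | forall e, e \notin E -> h e = 0].

Definition F_plus : set {ffun Y * Y -> R} :=
  [set h | F_space h /\ forall e, e \in E -> 0 < h e].

Definition W_space : set {ffun Y * Y -> R} :=
  [set P | F_plus P /\ forall y, \sum_(y' : Y) P (y, y') = 1].

Definition N_space : set {ffun Y * Y -> R} :=
  [set h | F_space h /\ exists (f : Y -> R) (c : R),
     forall y y', (y, y') \in E -> h (y, y') = f y' - f y + c].

Definition linearly_independent_mod_N (d : nat)
    (g : 'I_d -> {ffun Y * Y -> R}) : Prop :=
  forall a : 'I_d -> R,
    N_space [ffun e => \sum_(i < d) a i * g i e] -> forall i, a i = 0.

End EdgeFunctions.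

Arguments F_space {R Y} E.
Arguments F_plus {R Y} E.
Arguments W_space {R Y} E.
Arguments N_space {R Y} E.

Definition affinely_independent (R : realType) (T : finType) (n : nat)
    (p : 'I_n -> {ffun T -> R}) : Prop :=
  forall a : 'I_n -> R, \sum_(i < n) a i = 0 ->
    (forall t, \sum_(i < n) a i * p i t = 0) -> forall i, a i = 0.

Definition stationary (R : realType) (Y : finType)
    (P : {ffun Y * Y -> R}) (p : Y -> R) : Prop :=
  [/\ forall y, 0 <= p y,
      \sum_(y : Y) p y = 1
    & forall y', \sum_(y : Y) p y * P (y, y') = p y'].

(* Stated as a relation; for P in W_space E with E strongly connected, the
   stationary distribution, hence Q, exists and is unique. *)
Definition is_edge_measure (R : realType) (Y : finType)
    (P Q : {ffun Y * Y -> R}) : Prop :=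
  exists2 p : Y -> R, stationary P p
    & forall y y', Q (y, y') = p y * P (y, y').

Definition e_family (R : realType) (Y : finType) (E : {set Y * Y})
    (d : nat) (V : set {ffun Y * Y -> R}) : Prop :=
  exists P : 'rV[R]_d -> {ffun Y * Y -> R},
    [/\ V = range P,
        forall theta, W_space E (P theta)
      & exists (K : {ffun Y * Y -> R}) (g : 'I_d -> {ffun Y * Y -> R})
               (r : 'rV[R]_d -> Y -> R) (psi : 'rV[R]_d -> R),
        [/\ F_space E K,
            forall i, F_space E (g i),
            linearly_independent_mod_N E g
          & forall theta y y', (y, y') \in E ->
              ln (P theta (y, y')) =
                K (y, y') + \sum_(i < d) theta ord0 i * g i (y, y')
                + r theta y' - r theta y - psi theta]].

Section MFamilies.
Variables (R : realType) (Y : finType) (E : {set Y * Y}) (d : nat).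
Variables (C : {ffun Y * Y -> R}) (F : 'I_d -> {ffun Y * Y -> R}).

Definition m_point (xi : 'rV[R]_d) : {ffun Y * Y -> R} :=
  [ffun e => C e + \sum_(i < d) xi ord0 i * F i e].

Definition m_domain : set 'rV[R]_d :=
  [set xi | forall e, e \in E -> 0 < m_point xi e].

(* The d.+1 points C, C + F_1, ..., C + F_d. *)
Definition m_vertices (i : 'I_d.+1) : {ffun Y * Y -> R} :=
  if unlift ord0 i is Some j then [ffun e => C e + F j e] else C.

End MFamilies.

(* Every xi in m_domain must index a member of the family: m_point C F xi is
   required to be the edge measure of some P xi in W_space E. *)
Definition m_family (R : realType) (Y : finType) (E : {set Y * Y})
    (d : nat) (V : set {ffun Y * Y -> R}) : Prop :=
  exists (C : {ffun Y * Y -> R}) (F : 'I_d -> {ffun Y * Y -> R})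
         (P : 'rV[R]_d -> {ffun Y * Y -> R}),
    [/\ F_space E C /\ (forall i, F_space E (F i)),
        affinely_independent (m_vertices C F),
        \sum_(e in E) C e = 1 /\ (forall i, \sum_(e in E) F i e = 0),
        forall xi, m_domain E C F xi ->
          W_space E (P xi) /\ is_edge_measure (P xi) (m_point C F xi)
      & V = P @` m_domain E C F].

Section Lumping.
Variables (R : realType) (X Y : finType) (kappa : Y -> X) (E : {set Y * Y}).

Definition fiber (x : X) : {set Y} := [set y | kappa y == x]%SET.

Definition pairmap (e : Y * Y) : X * X := (kappa e.1, kappa e.2).

Definition lumped_edges : {set X * X} := [set pairmap e | e in E]%SET.

Definition lumpable (P : {ffun Y * Y -> R}) : Prop :=
  forall (x x' : X) (y1 y2 : Y), y1 \in fiber x -> y2 \in fiber x ->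
    \sum_(y' in fiber x') P (y1, y') = \sum_(y' in fiber x') P (y2, y').

Definition W_kappa : set {ffun Y * Y -> R} :=
  [set P | W_space E P /\ lumpable P].

(* The common value of the sums in [lumpable] is read off at an arbitrary
   point of the fiber of e.1, which is nonempty when kappa is surjective. *)
Definition push (P : {ffun Y * Y -> R}) : {ffun X * X -> R} :=
  [ffun e : X * X => if [pick y in fiber e.1] is Some y
                     then \sum_(y' in fiber e.2) P (y, y') else 0 : R].

Definition canonical_embedding (P0 : {ffun Y * Y -> R})
    (Pbar : {ffun X * X -> R}) : {ffun Y * Y -> R} :=
  [ffun e : Y * Y => if e \in E
                     then Pbar (pairmap e) * (P0 e / push P0 (pairmap e))
                     else 0].

Definition L_family (Pbar0 : {ffun X * X -> R}) : set {ffun Y * Y -> R} :=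
  [set P | W_kappa P /\ push P = Pbar0].

Definition J_family (P0 : {ffun Y * Y -> R}) : set {ffun Y * Y -> R} :=
  [set canonical_embedding P0 Pbar | Pbar in W_space lumped_edges].

End Lumping.

Arguments W_kappa {R X Y} kappa E.

(* Main.v *)
(** Two facts about a finite irreducible nonnegative matrix carry the proof:
    the existence of a positive (Perron) eigenvector, obtained by maximising
    [r] over the [v >= 0] of total mass 1 with [A v >= r v], and the minimum
    principle, by which the potentials relating two stochastic matrices with
    the same support are constant.

    For (i), [f |-> f x' - f x + \sum f] is an injection of functions on [X]
    into functions on [D] with image [N_space D]. A basis [g] of a complement,
    pulled back along [kappa], consists of the sufficient statistics; Perron
    normalisation of [exp (\sum theta_i g_i)] followed by the canonical
    embedding gives the family.

    For (ii), the edge measures of the fiber over [Pbar0] are the positive [Q]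
    of total mass 1 with [Q (y, S_x') = Pbar0 (kappa y, x') * (column sum at y)];
    summing over [x'] yields stationarity. The homogeneous equations are
    independent: a linear relation among them is a potential [b] with
    [P b = b + B] for some stochastic [P], so [B = 0] and [b] is constant. *)

Require Import Defs.
From mathcomp Require Import all_boot all_order all_algebra.
From mathcomp Require Import ring lra.
From mathcomp Require Import boolp classical_sets reals topology normedtype.
From mathcomp Require Import derive sequences exp.

Set Implicit Arguments.
Unset Strict Implicit.
Unset Printing Implicit Defensive.

Import Order.TTheory GRing.Theory Num.Theory.
Import numFieldNormedType.Exports.

Local Open Scope classical_set_scope.
Local Open Scope ring_scope.

(** * Nonnegative matrices: minimum principles and the spreading of positivity *)

Section NonnegativeMatrices.
Context {R : realType} {X : finType}.
Implicit Types (A P : {ffun X * X -> R}) (v : X -> R).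

Definition act A v : X -> R := fun x => \sum_x' A (x, x') * v x'.

Lemma argmin_exists (T : finType) (t0 : T) (S : {set T}) (f : T -> R) :
  t0 \in S -> exists2 t, t \in S & forall s, s \in S -> f t <= f s.
Proof.
by move=> h; case: (arg_minP f h) => t ht hmin; exists t.
Qed.

Lemma connect_invariant (e : rel X) (Q : X -> Prop) x y :
  (forall u w, e u w -> Q u -> Q w) -> connect e x y -> Q x -> Q y.
Proof.
move=> he /connectP[p hp ->]; elim: p x hp => //= z p IH x /andP[exz hp] Qx.
by apply: (IH z) => //; apply: he Qx.
Qed.

Lemma pos_sum_le (T : finType) (f : T -> R) t :
  (forall s, 0 <= f s) -> f t <= \sum_s f s.
Proof.
by move=> f0; rewrite (bigD1 t) //= lerDl sumr_ge0.
Qed.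

Lemma F_plus_ge0 (E : {set X * X}) P e : F_plus E P -> 0 <= P e.
Proof. by move=> [P0 Pp]; case: (boolP (e \in E)) => [/Pp/ltW|/P0->]. Qed.

(** At a minimiser, [v] dominates an average of values that are no smaller, so every out-neighbour
    is a minimiser too; strong connectivity carries this to all vertices. *)
Lemma superharmonic_const (E : {set X * X}) P v :
  strongly_connected E -> W_space E P ->
  (forall x, act P v x <= v x) -> forall x y, v x = v y.
Proof.
move=> scE [FP Psum] vs.
move=> x y.
have [m _ hm] := @argmin_exists X x [set: X]%SET v (finset.in_setT x).
have vm z : v z = v m.
  apply: (connect_invariant (Q := fun z => v z = v m) _ (scE m z)) => //.
  move=> u w uw vu.
  have key : \sum_z P (u, z) * (v z - v m) <= 0.
    under eq_bigr do rewrite mulrBr.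
    by rewrite sumrB -mulr_suml Psum mul1r subr_le0 -vu; apply: vs.
  have ge z' : 0 <= P (u, z') * (v z' - v m).
    by rewrite mulr_ge0 ?(F_plus_ge0 _ FP) // subr_ge0 hm ?finset.in_setT.
  have /le_trans/(_ key) := pos_sum_le w ge.
  rewrite pmulr_rle0 ?FP.2 // subr_le0 => h.
  by apply/eqP; rewrite eq_le h hm ?finset.in_setT.
by rewrite !vm.
Qed.

(** By the sign of [c], either [v] or [-v] is superharmonic, hence constant, and the equation then
    forces [c = 0]. The point [x] rules out an empty [X], where [c] would be arbitrary. *)
Lemma act_shift_const (E : {set X * X}) P v c :
  strongly_connected E -> W_space E P ->
  (forall x, act P v x = v x + c) -> forall x, c = 0 /\ forall y, v x = v y.
Proof.
move=> scE WP h x.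
have Psum := WP.2.
have vconst : forall y z, v y = v z.
  case: (leP c 0) => c0 y z.
    by apply: (superharmonic_const scE WP) => u; rewrite h gerDl.
  apply: oppr_inj.
  apply: (superharmonic_const (v := fun x => - v x) scE WP) => u.
  rewrite /act; under eq_bigr do rewrite mulrN.
  by rewrite sumrN lerN2 (h u : \sum_x' _ = _) lerDl ltW.
split=> //; have := h x.
rewrite /act; under eq_bigr do rewrite (vconst _ x).
rewrite -mulr_suml Psum mul1r -{1}[v x]addr0.
by move/addrI.
Qed.

(** Positivity of [v] makes [v] superharmonic when [s <= 1], and [-v] when [s > 1]. *)
Lemma positive_eigenvector_const (E : {set X * X}) P v s :
  strongly_connected E -> W_space E P -> (forall x, 0 < v x) ->
  (forall x, act P v x = s * v x) -> forall x, s = 1 /\ forall y, v x = v y.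
Proof.
move=> scE WP v0 h x.
have Psum := WP.2.
have vconst : forall y z, v y = v z.
  case: (leP s 1) => s1 y z.
    by apply: (superharmonic_const scE WP) => u; rewrite h ger_pMl.
  apply: oppr_inj.
  apply: (superharmonic_const (v := fun x => - v x) scE WP) => u.
  rewrite /act; under eq_bigr do rewrite mulrN.
  by rewrite sumrN lerN2 (h u : \sum_x' _ = _) ler_pMl // ltW.
split=> //; have := h x.
rewrite /act; under eq_bigr do rewrite (vconst _ x).
rewrite -mulr_suml Psum => /(mulIf (lt0r_neq0 (v0 x))).
by [].
Qed.

(** A repetition-free path from [x] to a point where [v] is positive has fewer than [#|X|] edges.
    Each iteration carries positivity back along one edge, and the identity summand never loses
    it. *)
Lemma add_act_iter_gt0 A v :
  strongly_connected [set e | 0 < A e]%SET -> (forall e, 0 <= A e) ->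
  (forall x, 0 <= v x) -> (exists x, 0 < v x) ->
  forall x, 0 < iter #|X| (fun w x => w x + act A w x) v x.
Proof.
move=> scA A0 v0 [x0 vx0] x.
set S := fun w x => w x + act A w x.
have Sge n : forall x, 0 <= iter n S v x.
  elim: n => //= n IH y; rewrite addr_ge0 // sumr_ge0 // => z _.
  by rewrite mulr_ge0.
have Sincr n m y : 0 < iter n S v y -> 0 < iter (m + n) S v y.
  move=> h; elim: m => //= m IH; rewrite ltr_wpDr // sumr_ge0 // => z _.
  by rewrite mulr_ge0.
have /connectP[p hp hl] := scA x x0.
case/shortenP: hp hl => q hq uq _ hl {p}.
have sq : (size q <= #|X|)%N.
  by apply: ltnW; have := max_card (mem (x :: q)); rewrite (card_uniqP uq).
rewrite -(subnK sq); apply: Sincr => {uq sq}.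
elim: q x hq hl => /= [|y q IH] x; first by move=> _ <-.
rewrite inE => /andP[Axy hq] hl.
rewrite /S -/S ltr_wpDl //.
apply: (@lt_le_trans _ _ (A (x, y) * iter (size q) S v y)).
  by rewrite mulr_gt0 // IH.
apply: (@pos_sum_le _ (fun z => A (x, z) * iter (size q) S v z)) => z.
by rewrite mulr_ge0.
Qed.

End NonnegativeMatrices.

(** * Existence of a positive eigenvector *)

Section Perron.
Context {R : realType} {X : finType}.
Variable A : {ffun X * X -> R}.
Hypothesis A_ge0 : forall e, 0 <= A e.

(** Feasible pairs of the Collatz-Wielandt problem; for irreducible [A] the largest [r] is the
    Perron root. *)
Definition collatz_wielandt (r : R) (v : X -> R) : Prop :=
  [/\ 0 <= r, forall x, 0 <= v x, \sum_x v x = 1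
    & forall x, r * v x <= act A v x].

Lemma collatz_wielandt_bound r v :
  collatz_wielandt r v ->
  r <= \sum_e A e /\ forall x, v x <= 1.
Proof.
move=> [r0 v0 v1 hv].
have vle1 x : v x <= 1 by rewrite -v1; apply: pos_sum_le.
split=> //; rewrite -[r]mulr1 -v1 mulr_sumr.
rewrite (eq_bigr (fun e => A (e.1, e.2))); last by case.
rewrite -(pair_big xpredT xpredT (fun x y => A (x, y))) /=.
apply: ler_sum => x _; apply: (le_trans (hv x)).
by apply: ler_sum => y _; rewrite ler_piMr.
Qed.

Lemma collatz_wielandt_max (x0 : X) :
  exists r v, collatz_wielandt r v /\
    forall r' v', collatz_wielandt r' v' -> r' <= r.
Proof.
(* A pair [(r, v)] is coded as one function on [option X], with [r] at [None], so that Tychonoff's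
   theorem gives a compact box. The side [M] bounds both [r] and the entries of [v]. *)
pose T := prod_topology (fun _ : option X => R : topologicalType).
pose M := 1 + \sum_e A e.
have M1 : 1 <= M by rewrite lerDl sumr_ge0.
pose box := [set f : T | forall i, `[0, M]%classic (f i)].
have cbox : compact box.
  apply: (@tychonoff _ (fun _ => R) (fun _ => `[0, M]%classic)) => i.
  exact: segment_compact.
have cproj i : continuous (fun f : T => f i).
  exact: (@proj_continuous (option X) (fun _ => R : topologicalType) i).
have csum (I : finType) (g : I -> T -> R) : (forall i, continuous (g i)) ->
    continuous (fun f : T => \sum_i g i f).
  move=> cg f.
  have := @cvg_big R I +%R 0 xpredT (@add_continuous R) T (nbhs f)
    (index_enum I) g (g^~ f) (nbhs_filter f).
  apply.
  by move=> i _; apply: cg.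
pose simplex := [set f : T | \sum_x f (Some x) = 1].
pose sub (x : X) := [set f : T | 
   f None * f (Some x) - \sum_y A (x, y) * f (Some y) <= 0].
have clsimplex : closed simplex.
  apply: ((continuous_closedP (fun f : T => \sum_x f (Some x))).1 _ [set 1]).
    by apply: csum => x; apply: cproj.
  exact: closed_eq.
have clsub : closed (\bigcap_x sub x).
  apply: closed_bigI => x _.
  have cl : continuous (fun f : T => f None * f (Some x)).
    by move=> f; exact: (cvgM (cproj None f) (cproj (Some x) f)).
  have cr : continuous (fun f : T => \sum_y A (x, y) * f (Some y)).
    by apply: csum => y f; exact: (cvgMl_tmp (cproj (Some y) f)).
  apply: ((continuous_closedP (fun f : T => f None * f (Some x)
     - \sum_y A (x, y) * f (Some y))).1 _ [set z | z <= 0]).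
    by move=> f; exact: (cvgB (cl f) (cr f)).
  exact: closed_le.
pose K := (box `&` simplex) `&` \bigcap_x sub x.
have cK : compact K by do 2 apply: compact_closedI => //.
have KP f : K f <-> collatz_wielandt (f None) (fun x => f (Some x)).
  split=> [[[fb fs] fsub]|h].
    split=> //.
    - by have := fb None; rewrite /= in_itv /= => /andP[].
    - by move=> x; have := fb (Some x); rewrite /= in_itv /= => /andP[].
    - by move=> x; have := fsub x I; rewrite /sub /= subr_le0.
  have [f0 fx0 f1 hf] := h; have [rb vb] := collatz_wielandt_bound h.
  split; last by move=> x _; rewrite /sub /= subr_le0; apply: hf.
  split=> // -[x|]; rewrite /= in_itv /=.
    by rewrite fx0 (le_trans (vb x)).
  by rewrite f0 (le_trans rb) // lerDr.
pose f0 : T := fun i => if i is Some x then (x == x0)%:R else 0.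
have K0 : K f0.
  apply/KP; split=> //=.
  - by rewrite (bigD1 x0) //= eqxx big1 ?addr0 // => x /negPf ->.
  - by move=> x; rewrite mul0r sumr_ge0 // => y _; rewrite mulr_ge0.
have [f /set_mem/KP Kf fmax] :=
  compact_EVT_max (ex_intro _ f0 K0) cK (continuous_subspaceT (cproj None)).
exists (f None), (fun x => f (Some x)); split=> // r v rv.
pose g : T := fun i => if i is Some x then v x else r.
by apply: (fmax g); apply/mem_set/KP.
Qed.

Lemma actZ c v x : act A (fun y => c * v y) x = c * act A v x.
Proof. by rewrite /act mulr_sumr; apply: eq_bigr => y _; rewrite mulrCA. Qed.

Lemma actD v w x : act A (fun y => v y + w y) x = act A v x + act A w x.
Proof. by rewrite /act -big_split; apply: eq_bigr => y _; rewrite mulrDr. Qed.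

Theorem perron_eigenvector :
  strongly_connected [set e | 0 < A e]%SET -> (2 <= #|X|)%N ->
  exists (s : R) (v : X -> R),
    [/\ 0 < s, forall x, 0 < v x & forall x, act A v x = s * v x].
Proof.
move=> scA X2.
have /card_gt0P[x0 _] : (0 < #|X|)%N by apply: leq_trans X2.
have [r [v [[r0 v0 v1 hv] rmax]]] := collatz_wielandt_max x0.
pose S (w : X -> R) x := w x + act A w x.
have Sge0 w : (forall x, 0 <= w x) -> forall x, 0 <= S w x.
  by move=> w0 x; rewrite addr_ge0 // sumr_ge0 // => z _; rewrite mulr_ge0.
have itge0 n w : (forall x, 0 <= w x) -> forall x, 0 <= iter n S w x.
  by move=> w0; elim: n => //= n IH; apply: Sge0.
(* The residual [z] must vanish: otherwise, as [S] commutes with [A], the vector [u] satisfies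
   [A u - r u = S^n z > 0] everywhere, and [r] could be increased. *)
pose z x := act A v x - r * v x.
have z0 x : 0 <= z x by rewrite subr_ge0.
have vpos : exists x, 0 < v x.
  apply/not_existsP => h; have : \sum_x v x <= 0.
    by apply: sumr_le0 => x _; rewrite leNgt; apply/negP.
  by rewrite v1 ler10.
pose n := #|X|; pose u := iter n S v.
have u0 x : 0 < u x by apply: add_act_iter_gt0.
have uz k x : act A (iter k S v) x = r * iter k S v x + iter k S z x.
  elim: k x => [|k IH] x /=; first by rewrite /z addrC subrK.
  rewrite actD {2}/S IH.
  have -> : act A (act A (iter k S v)) x =
     act A (fun y => r * iter k S v y + iter k S z y) x.
    by apply: eq_bigr => y _; rewrite IH.
  by rewrite actD actZ /S; ring.
have zz x : z x = 0.
  apply/eqP/negPn/negP => zx.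
  have zpos : exists y, 0 < z y by exists x; rewrite lt_def zx z0.
  have it0 y : 0 < iter n S z y by apply: add_act_iter_gt0.
  have [m _ hm] := @argmin_exists _ X x [set: X]%SET (iter n S z)
    (finset.in_setT x).
  pose U := \sum_y u y.
  have U0 : 0 < U.
    by apply: lt_le_trans (u0 x) (pos_sum_le _ _) => y; apply: ltW.
  (* The gain is the minimum of [S^n z] over the mass of [u]: since [u y <= U], this gain times
     [u y] stays below [S^n z] at [y]. *)
  have : r + iter n S z m / U <= r.
    apply: (rmax _ (fun y => U^-1 * u y)); split.
    - by rewrite addr_ge0 // divr_ge0 // ltW.
    - by move=> y; rewrite mulr_ge0 ?invr_ge0 // ltW.
    - by rewrite -mulr_sumr mulVf // gt_eqF.
    move=> y; rewrite actZ uz mulrCA ler_pM2l ?invr_gt0 // mulrDl lerD2l.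
    apply: le_trans (hm y _); last by rewrite finset.in_setT.
    rewrite -mulrA ler_piMr ?(ltW (it0 _)) // mulrC ler_pdivrMr // mul1r.
    by apply: pos_sum_le => w; apply: ltW.
  by rewrite gerDl leNgt divr_gt0.
have Au x : act A u x = r * u x.
  have iter0 k y : iter k S z y = 0.
    elim: k y => [|k IH] y //=; rewrite /S IH add0r /act big1 // => w _.
    by rewrite IH mulr0.
  by rewrite uz iter0 addr0.
(* Without a positive entry no path would join two distinct vertices; such an entry makes [r]
   positive. *)
have [x1 [y1 Axy]] : exists x y, 0 < A (x, y).
  apply/not_existsP => h.
  have /card_gt1P[a [b [_ _ ab]]] := X2.
  suff : a = b by apply/eqP.
  apply/esym.
  apply: (connect_invariant (Q := fun t => t = a) _ (scA a b)) => //.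
  by move=> p q; rewrite inE => Apq; case: (h p); exists q.
exists r, u; split=> //.
have : 0 < r * u x1.
  rewrite -Au; apply: lt_le_trans (_ : A (x1, y1) * u y1 <= _).
    by rewrite mulr_gt0.
  by apply: (@pos_sum_le _ _ (fun y => A (x1, y) * u y)) => y;
     rewrite mulr_ge0 // ltW.
by rewrite pmulr_lgt0.
Qed.

End Perron.

(** * Kernel and complement of a system of independent linear constraints *)

Section LinearAlgebra.
Context {K : fieldType} {Z W : finType}.
Variables (E : {set Z}) (N : {set W}) (m : Z -> W -> K).
Hypothesis m_inj : forall l : W -> K,
  (forall e, e \in E -> \sum_(w in N) l w * m e w = 0) ->
  forall w, w \in N -> l w = 0.

Let M : 'M[K]_(#|N|, #|E|) := \matrix_(i, j) m (enum_val j) (enum_val i).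

Definition extend_row (T : finType) (S : {set T}) (w : 'rV[K]_#|S|) :
    {ffun T -> K} :=
  [ffun e => \sum_i w 0 i *+ (e == enum_val i)].

Lemma extend_row_val (T : finType) (S : {set T}) (w : 'rV[K]_#|S|) i :
  extend_row w (enum_val i) = w 0 i.
Proof.
rewrite ffunE (bigD1 i) //= eqxx big1 ?addr0 // => j ji.
by rewrite (inj_eq enum_val_inj) eq_sym (negPf ji).
Qed.

Lemma extend_row_out (T : finType) (S : {set T}) (w : 'rV[K]_#|S|) e :
  e \notin S -> extend_row w e = 0.
Proof.
move=> eS; rewrite ffunE big1 // => i _; case: eqP => // h.
by rewrite h enum_valP in eS.
Qed.

Lemma enum_valS (T : finType) (S : {set T}) (Q : T -> Prop) :
  (forall i : 'I_#|S|, Q (enum_val i)) -> forall e, e \in S -> Q e.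
Proof. by move=> h e eS; rewrite -(enum_rankK_in eS eS). Qed.

Lemma constraint_matrix_free : row_free M.
Proof.
apply: inj_row_free => v vM; apply/rowP => i; rewrite mxE.
rewrite -extend_row_val; apply: m_inj; last exact: enum_valP.
apply: enum_valS => j; rewrite big_enum_val /=.
transitivity ((v *m M) 0 j); last by rewrite vM mxE.
by rewrite mxE; apply: eq_bigr => k _; rewrite extend_row_val mxE.
Qed.

Lemma constraint_card_le : (#|N| <= #|E|)%N.
Proof.
by rewrite -(eqP (constraint_matrix_free : \rank M == _)) rank_leq_col.
Qed.

(** The rows of a base of the kernel of [M^T], whose rank is [#|E| - #|N|] because [M] has
    independent rows. *)
Lemma constraint_kernel_basis :
  exists F : 'I_(#|E| - #|N|) -> {ffun Z -> K},
  [/\ forall i e, e \notin E -> F i e = 0,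
      forall i w, w \in N -> \sum_(e in E) F i e * m e w = 0,
      forall a : 'I_(#|E| - #|N|) -> K,
        (forall e, \sum_i a i * F i e = 0) -> forall i, a i = 0
    & forall h : Z -> K,
        (forall w, w \in N -> \sum_(e in E) h e * m e w = 0) ->
        exists a : 'I_(#|E| - #|N|) -> K,
          forall e, e \in E -> h e = \sum_i a i * F i e].
Proof.
have rk : \rank (kermx M^T) = (#|E| - #|N|)%N.
  by rewrite mxrank_ker mxrank_tr (eqP (constraint_matrix_free : \rank M == _)).
rewrite -rk; pose B := row_base (kermx M^T).
exists (fun i => extend_row (row i B)); split.
- by move=> i e; apply: extend_row_out.
- move=> i w wN.
  have BM : B *m M^T = 0 by apply/eqP; rewrite -sub_kermx eq_row_base.
  move: w wN; apply: enum_valS => j; rewrite big_enum_val /=.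
  transitivity ((B *m M^T) i j); last by rewrite BM mxE.
  by rewrite mxE; apply: eq_bigr => k _; rewrite extend_row_val !mxE.
- move=> a ha.
  suff av : \row_i a i = 0 by move=> i; have /rowP/(_ i) := av; rewrite !mxE.
  apply/eqP; rewrite -(mulmx_free_eq0 _ (row_base_free (kermx M^T))).
  apply/eqP/rowP => j; rewrite mxE [RHS]mxE -[RHS](ha (enum_val j)).
  by apply: eq_bigr => i _; rewrite extend_row_val !mxE.
move=> h hh; pose v : 'rV_#|E| := \row_j h (enum_val j).
have : (v <= B)%MS.
  rewrite eq_row_base sub_kermx; apply/eqP/rowP => i; rewrite mxE [RHS]mxE.
  rewrite -[RHS](hh (enum_val i)) ?enum_valP // [RHS]big_enum_val /=.
  by apply: eq_bigr => k _; rewrite !mxE.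
case/submxP => a va; exists (fun i => a 0 i); apply: enum_valS => j.
transitivity (v 0 j); first by rewrite mxE.
by rewrite va mxE; apply: eq_bigr => i _; rewrite extend_row_val [in RHS]mxE.
Qed.

(** The rows of a base of a complement to the row space of [M]: independence modulo the constraints
    is the trivial intersection, and spanning is that the two spaces fill everything. *)
Lemma constraint_complement_basis :
  exists g : 'I_(#|E| - #|N|) -> {ffun Z -> K},
  [/\ forall i e, e \notin E -> g i e = 0,
      forall (a : 'I_(#|E| - #|N|) -> K) (l : W -> K),
        (forall e, e \in E -> \sum_i a i * g i e = \sum_(w in N) l w * m e w) ->
        forall i, a i = 0
    & forall h : Z -> K,
        exists (a : 'I_(#|E| - #|N|) -> K) (l : W -> K),
          forall e, e \in E ->
            h e = \sum_i a i * g i e + \sum_(w in N) l w * m e w].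
Proof.
have rk : \rank (M^C)%MS = (#|E| - #|N|)%N.
  by rewrite mxrank_compl (eqP (constraint_matrix_free : \rank M == _)).
rewrite -rk; pose B := row_base (M^C)%MS.
exists (fun i => extend_row (row i B)); split.
- by move=> i e; apply: extend_row_out.
- move=> a l hal.
  suff av : \row_i a i = 0 by move=> i; have /rowP/(_ i) := av; rewrite !mxE.
  apply/eqP; rewrite -(mulmx_free_eq0 _ (row_base_free (M^C)%MS)) -submx0.
  rewrite -(capmx_compl M) sub_capmx; apply/andP; split.
    apply/submxP; exists (\row_i l (enum_val i)).
    apply/rowP => j; rewrite mxE [RHS]mxE.
    transitivity (\sum_i a i * extend_row (row i B) (enum_val j)).
      by apply: eq_bigr => i _; rewrite extend_row_val !mxE.
    rewrite hal ?enum_valP // big_enum_val /=.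
    by apply: eq_bigr => k _; rewrite !mxE.
  by apply: submx_trans (submxMl _ _) _; rewrite eq_row_base.
move=> h; pose v : 'rV_#|E| := \row_j h (enum_val j).
have : (v <= M + B)%MS.
  rewrite (adds_eqmx (eqmx_refl M) (eq_row_base _)).
  by apply: submx_full; apply: addsmx_compl_full.
case/sub_addsmxP => -[l a] /= va; exists (fun i => a 0 i), (extend_row l).
apply: enum_valS => j.
transitivity (v 0 j); first by rewrite mxE.
rewrite va mxE addrC; congr (_ + _); rewrite mxE.
  by apply: eq_bigr => i _; rewrite extend_row_val [in RHS]mxE.
rewrite [RHS]big_enum_val /=.
by apply: eq_bigr => i _; rewrite extend_row_val [in LHS]mxE.
Qed.

End LinearAlgebra.

(** * Lumpable chains, pushforward and canonical embedding *)

Section LumpedChains.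
Context {R : realType} {X Y : finType}.
Variables (kappa : Y -> X) (E : {set Y * Y}).
Hypothesis kappa_surj : forall x, exists y, kappa y = x.
Local Notation D := (lumped_edges kappa E).
Implicit Types (P : {ffun Y * Y -> R}) (Pbar : {ffun X * X -> R}).

Lemma sum_fibers (f : Y -> R) :
  \sum_y f y = \sum_x \sum_(y in fiber kappa x) f y.
Proof.
rewrite (partition_big kappa xpredT) //=; apply: eq_bigr => x _.
by apply: eq_bigl => y; rewrite inE.
Qed.

Lemma pairmap_lumped y y' : (y, y') \in E -> (kappa y, kappa y') \in D.
Proof. by move=> h; apply/imsetP; exists (y, y'). Qed.

Lemma lumped_strongly_connected : strongly_connected E -> strongly_connected D.
Proof.
move=> scE x x'; have [y <-] := kappa_surj x; have [y' <-] := kappa_surj x'.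
apply: (connect_invariant
  (Q := fun z => connect (fun u v => (u, v) \in D) (kappa y) (kappa z))
  _ (scE y y')).
  move=> u v uv h; apply: connect_trans h _; apply: connect1.
  exact: pairmap_lumped.
exact: connect0.
Qed.

Lemma pushE P y x' : lumpable kappa P ->
  push kappa P (kappa y, x') = \sum_(y' in fiber kappa x') P (y, y').
Proof.
move=> lP; rewrite ffunE /=.
case: pickP => [z zf|/(_ y)]; last by rewrite inE eqxx.
by apply: (lP (kappa y)) => //; rewrite inE.
Qed.

(** The mass sent into the fiber of [x'] is the same from every point of the fiber of [kappa y], and
    positive from one of them, hence from [y]. *)
Lemma lumped_edge_lift P y x' : W_kappa kappa E P -> (kappa y, x') \in D ->
  exists2 y', kappa y' = x' & (y, y') \in E.
Proof.
move=> [[WP _] lP] /imsetP[[u w] uw [ku kw]].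
have pos : 0 < \sum_(y' in fiber kappa x') P (y, y').
  rewrite (lP (kappa y) x' y u) ?inE ?ku //.
  apply: lt_le_trans (WP.2 _ uw) _.
  rewrite (bigD1 w) ?inE ?kw //= lerDl sumr_ge0 // => z _.
  exact: F_plus_ge0 WP.
have [/existsP[y' /andP[/eqP ky' yy']]|/existsPn h] :=
  boolP [exists y', (kappa y' == x') && ((y, y') \in E)]; first by exists y'.
move: pos; rewrite big1 ?ltxx // => z; rewrite inE => kz; apply: WP.1.
by have := h z; rewrite kz.
Qed.

Lemma push_W P : W_kappa kappa E P -> W_space D (push kappa P).
Proof.
move=> WkP; have [[WP Psum] lP] := WkP; split; first split.
- move=> [x x']; have [y <-] := kappa_surj x => h.
  rewrite pushE // big1 // => y'; rewrite inE => /eqP ky'; apply: WP.1.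
  by apply: contra h; rewrite -ky'; apply: pairmap_lumped.
- move=> [x x']; have [y <-] := kappa_surj x => h.
  have [y' <- yy'] := lumped_edge_lift WkP h.
  rewrite pushE //; apply: lt_le_trans (WP.2 _ yy') _.
  rewrite (bigD1 y') ?inE //= lerDl sumr_ge0 // => z _.
  exact: F_plus_ge0 WP.
move=> x; have [y <-] := kappa_surj x.
rewrite -(Psum y) sum_fibers; apply: eq_bigr => x' _; exact: pushE.
Qed.

(** Lumpability, pushforward and row sums all reduce to prescribed block sums, which are linear in
    [P]. *)
Lemma L_familyP Pbar P : W_space D Pbar ->
  L_family kappa E Pbar P <->
  F_plus E P /\
  forall y x', \sum_(y' in fiber kappa x') P (y, y') = Pbar (kappa y, x').
Proof.
move=> WPbar; split=> [[[[FP Psum] lP] <-]|[FP hP]].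
  by split=> // y x'; rewrite pushE.
have lP : lumpable kappa P.
  by move=> x x' y1 y2; rewrite !inE => /eqP k1 /eqP k2; rewrite !hP k1 k2.
split; last first.
  by apply/ffunP => -[x x']; have [y <-] := kappa_surj x; rewrite pushE.
split=> //; split=> // y; rewrite sum_fibers -[RHS](WPbar.2 (kappa y)).
by apply: eq_bigr => x' _.
Qed.

(** Over an edge of [D], [P] divided by its pushforward is a probability vector on each row block,
    so the block sums of the embedding are those of [Pbar]. *)
Lemma canonical_embedding_L P Pbar : W_kappa kappa E P -> W_space D Pbar ->
  L_family kappa E Pbar (canonical_embedding kappa E P Pbar).
Proof.
move=> WkP WPbar; have WpP := push_W WkP; apply/L_familyP => //.
have [[FP Psum] lP] := WkP; split; first split.
- by move=> e eE; rewrite ffunE (negPf eE).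
- move=> [y y'] eE; rewrite ffunE eE; have eD := pairmap_lumped eE.
  by rewrite mulr_gt0 ?divr_gt0 ?WPbar.1.2 ?WpP.1.2 ?FP.2.
move=> y x'; case: (boolP ((kappa y, x') \in D)) => h; last first.
  rewrite (WPbar.1.1 _ h) big1 // => y'; rewrite inE => /eqP ky'; rewrite ffunE.
  case: ifP => // yy'; move: h; rewrite -ky' => /negP[].
  exact: pairmap_lumped.
have p0 := WpP.1.2 _ h.
transitivity (Pbar (kappa y, x') / push kappa P (kappa y, x')
   * \sum_(y' in fiber kappa x') P (y, y')); last first.
  by rewrite -pushE // mulfVK // gt_eqF.
rewrite mulr_sumr; apply: eq_bigr => y'; rewrite inE => /eqP ky'.
rewrite [LHS]ffunE /Defs.pairmap /= ky'.
case: ifPn => [_|/FP.1 ->]; last by rewrite mulr0.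
by rewrite mulrA mulrAC.
Qed.

End LumpedChains.
(** A Perron eigenvector of the transpose, whose graph is the reversed one; summing the eigenvalue
    equation over all vertices gives eigenvalue 1 because the rows of [P] sum to 1. *)
Lemma stationary_exists {R : realType} {Y : finType} (E : {set Y * Y})
    (P : {ffun Y * Y -> R}) :
  strongly_connected E -> (2 <= #|Y|)%N -> W_space E P ->
  exists p : Y -> R, stationary P p /\ forall y, 0 < p y.
Proof.
move=> scE Y2 [FP Psum].
pose A : {ffun Y * Y -> R} := [ffun e => P (e.2, e.1)].
have A0 e : 0 <= A e by rewrite ffunE; apply: F_plus_ge0 FP.
have scA : strongly_connected [set e | 0 < A e]%SET.
  move=> y y'.
  have : connect (fun u v => (v, u) \in E) y y'.
    by rewrite (connect_rev (fun u v => (u, v) \in E)); exact: scE.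
  apply: connect_sub => u v vu; apply: connect1.
  by rewrite inE ffunE; exact: FP.2.
have [s [v [s0 v0 hv]]] := perron_eigenvector A0 scA Y2.
have hv' y : \sum_u v u * P (u, y) = s * v y.
  by rewrite -hv; apply: eq_bigr => u _; rewrite ffunE mulrC.
have /card_gt0P[y0 _] : (0 < #|Y|)%N by apply: leq_trans Y2.
have V0 : 0 < \sum_y v y.
  by apply: lt_le_trans (v0 y0) (pos_sum_le _ _) => y; apply: ltW.
have s1 : s = 1.
  apply: (mulIf (lt0r_neq0 V0)); rewrite mul1r mulr_sumr.
  under eq_bigr do rewrite -hv'.
  rewrite exchange_big; apply: eq_bigr => u _ /=.
  by rewrite -mulr_sumr Psum mulr1.
exists (fun y => v y / \sum_u v u); split; last by move=> y; rewrite divr_gt0.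
split=> [y||y].
- by rewrite divr_ge0 // ltW.
- by rewrite -mulr_suml mulfV // gt_eqF.
by under eq_bigr do rewrite mulrAC; rewrite -mulr_suml hv' s1 mul1r.
Qed.

(** * The chains over a fixed lumped chain as an m-family *)

Section LumpingFibers.
Context {R : realType} {X Y : finType}.
Variables (kappa : Y -> X) (E : {set Y * Y}) (Pbar0 : {ffun X * X -> R}).
Hypothesis kappa_surj : forall x, exists y, kappa y = x.
Hypothesis scE : strongly_connected E.
Hypothesis Y2 : (2 <= #|Y|)%N.
Local Notation D := (lumped_edges kappa E).
Hypothesis WPbar0 : W_space D Pbar0.
Variable P0 : {ffun Y * Y -> R}.
Hypothesis WkP0 : W_kappa kappa E P0.

(** Indices of the balance equations: for the other pairs, no edge joins [y] to the fiber of [x']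
    and both sides are zero. *)
Let N : {set Y * X} := [set w | (kappa w.1, w.2) \in D]%SET.

Lemma card_block_rows : #|N| = \sum_(e in D) #|fiber kappa e.1|.
Proof.
rewrite -sum1_card (partition_big (fun w => (kappa w.1, w.2)) (mem D)) /=;
  last first.
  by move=> w; rewrite inE.
apply: eq_bigr => -[x x'] eD; rewrite sum1_card /=.
have <- : #|finset.setX (fiber kappa x) [set x']%SET| = #|fiber kappa x|.
  by rewrite cardsX cards1 muln1.
apply: eq_card => -[y z]; rewrite !inE /= -topredE /= inE xpair_eqE /=.
by case: eqP => [->|]; case: eqP => [->|]; rewrite ?andbF //= eD.
Qed.

(* The coefficient of [h e] in
   [h (y, S_x') - Pbar0 (kappa y, x') * (column sum of h at y - total of h)] with
   [w = (y, x')]: subtracting the total folds the normalisation into the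
   [#|N|] balance equations, which alone sum to a trivial one. *)
Let m (e : Y * Y) (w : Y * X) : R :=
  ((e.1 == w.1) && (kappa e.2 == w.2))%:R
  - Pbar0 (kappa w.1, w.2) * ((e.2 == w.1)%:R - 1).

Lemma block_constraints_inj (l : Y * X -> R) :
  (forall e, e \in E -> \sum_(w in N) l w * m e w = 0) ->
  forall w, w \in N -> l w = 0.
Proof.
move=> hl.
pose b y := \sum_x' l (y, x') * Pbar0 (kappa y, x').
pose B := \sum_y b y.
have sumN (f : Y * X -> R) : \sum_(w in N) f w * Pbar0 (kappa w.1, w.2) =
    \sum_y \sum_x' f (y, x') * Pbar0 (kappa y, x').
  rewrite big_mkcond pair_big /=; apply: eq_bigr => -[y x'] _ /=.
  by rewrite inE /=; case: ifPn => // h; rewrite (WPbar0.1.1 _ h) mulr0.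
have lE y y' : (y, y') \in E -> l (y, kappa y') = b y' - B.
  move=> yy'; have := hl _ yy'.
  have -> : \sum_(w in N) l w * m (y, y') w = 
     \sum_(w in N) l w * ((y == w.1) && (kappa y' == w.2))%:R
     - \sum_(w in N) (l w * (y' == w.1)%:R) * Pbar0 (kappa w.1, w.2)
     + \sum_(w in N) l w * Pbar0 (kappa w.1, w.2).
    by rewrite -sumrB -big_split; apply: eq_bigr => w _; rewrite /m /=; ring.
  rewrite !sumN (bigD1 (y, kappa y')) ?inE ?pairmap_lumped //= !eqxx mulr1.
  rewrite big1 ?addr0; last first.
    move=> -[u x'] /andP[_]; rewrite xpair_eqE /= => h.
    by rewrite (eq_sym y) (eq_sym _ x') (negPf h) mulr0.
  rewrite [X in _ - X + _](bigD1 y') //= [X in _ - (_ + X) + _]big1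
    ?addr0; last first.
    move=> u uy; rewrite big1 // => x' _.
    by rewrite (eq_sym y') (negPf uy) mulr0 mul0r.
  rewrite eqxx; under eq_bigr do rewrite mulr1.
  rewrite -/(b y') -[X in _ + X]/B => h; lra.
have [[[FP Psum] lP] hP] := canonical_embedding_L kappa_surj WkP0 WPbar0.
set P := canonical_embedding _ _ _ _ in FP Psum lP hP.
have Pblock y x' : \sum_(y' in fiber kappa x') P (y, y') = Pbar0 (kappa y, x').
  by rewrite -hP pushE.
(* Average [lE] over the row [P (y, _)]: the block sums of [P] turn the average of [l (y, kappa y')]
   into [b y]. *)
have Pb y : act P b y = b y + B.
  transitivity (\sum_y' P (y, y') * l (y, kappa y') + \sum_y' P (y, y') * B).
    rewrite -big_split; apply: eq_bigr => y' _ /=.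
    case: (boolP ((y, y') \in E)) => [/lE->|/FP.1->]; first by ring.
    by rewrite !mul0r addr0.
  rewrite -mulr_suml Psum mul1r (sum_fibers kappa); congr (_ + _).
  apply: eq_bigr => x' _; rewrite -Pblock mulr_sumr; apply: eq_bigr => y'.
  by rewrite inE => /eqP->; rewrite mulrC.
have b0 y : b y = 0.
  have [B0 bc] := act_shift_const scE (conj FP Psum) Pb y.
  move: B0; rewrite /B; under eq_bigr do rewrite -bc.
  rewrite sumr_const => /eqP; rewrite mulrn_eq0 -leqn0 leqNgt.
  by rewrite (leq_trans _ Y2) //= => /eqP.
move=> [y x']; rewrite inE /= => h.
have [y' <- yy'] := lumped_edge_lift WkP0 h.
by rewrite (lE _ _ yy') b0 /B big1 ?subr0.
Qed.

(** Lumping onto [Pbar0] and stationarity in one linear system: the stationary mass at [y] is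
    expressed as a column sum. *)
Definition block_balanced (h : Y * Y -> R) : Prop :=
  forall y x', \sum_(y' in fiber kappa x') h (y, y') =
    Pbar0 (kappa y, x') * \sum_u h (u, y).

Lemma sum_pairs (h : Y * Y -> R) : \sum_e h e = \sum_y \sum_y' h (y, y').
Proof.
by rewrite pair_big; apply: eq_bigr => -[].
Qed.

Lemma sum_edges (h : Y * Y -> R) : (forall e, e \notin E -> h e = 0) ->
  \sum_(e in E) h e = \sum_e h e.
Proof.
by move=> h0; rewrite big_mkcond; apply: eq_bigr => e _; case: ifPn => // /h0.
Qed.

(** Summing the folded equations over [x'] and then over [y] gives [t = t - #|Y| t] for the total
    [t], so [t = 0] and the folded term disappears. *)
Lemma block_constraintsP (h : Y * Y -> R) : (forall e, e \notin E -> h e = 0) ->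
  (forall w, w \in N -> \sum_(e in E) h e * m e w = 0) <->
  block_balanced h /\ \sum_e h e = 0.
Proof.
move=> h0.
have me y x' : \sum_(e in E) h e * m e (y, x') =
    \sum_(y' in fiber kappa x') h (y, y')
    - Pbar0 (kappa y, x') * (\sum_u h (u, y) - \sum_e h e).
  rewrite sum_edges; last by move=> e /h0->; rewrite mul0r.
  have -> : \sum_e h e * m e (y, x') =
     \sum_e h e * ((e.1 == y) && (kappa e.2 == x'))%:R
     - Pbar0 (kappa y, x') * (\sum_e h e * (e.2 == y)%:R - \sum_e h e).
    rewrite -sumrB mulr_sumr -sumrB; apply: eq_bigr => e _; rewrite /m /=; ring.
  congr (_ - _ * (_ - _)); rewrite sum_pairs.
    rewrite (bigD1 y) //= [X in _ + X]big1 ?addr0; last first.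
      by move=> u uy; rewrite big1 // => z _; rewrite (negPf uy) mulr0.
    rewrite big_mkcond [RHS]big_mkcond; apply: eq_bigr => z _ /=.
    by rewrite inE eqxx /=; case: eqP; rewrite ?mulr1 ?mulr0.
  apply: eq_bigr => u _; rewrite (bigD1 y) //= eqxx mulr1 big1 ?addr0 //.
  by move=> z zy; rewrite (negPf zy) mulr0.
split=> [hN|[hb ht] [y x'] _]; last by rewrite me hb ht subr0 subrr.
have hb y x' : \sum_(y' in fiber kappa x') h (y, y') =
    Pbar0 (kappa y, x') * (\sum_u h (u, y) - \sum_e h e).
  apply/eqP; rewrite -subr_eq0 -me; case: (boolP ((y, x') \in N)) => [/hN->//|].
  rewrite inE /= => yx; rewrite me (WPbar0.1.1 _ yx) mul0r subr0 big1 //.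
  move=> y'; rewrite inE => /eqP ky'; apply: h0.
  by apply: contra yx; rewrite -ky'; apply: pairmap_lumped.
suff ht : \sum_e h e = 0 by split=> // y x'; rewrite hb ht subr0.
have hrow y : \sum_y' h (y, y') = \sum_u h (u, y) - \sum_e h e.
  rewrite (sum_fibers kappa); under eq_bigr do rewrite hb.
  by rewrite -mulr_suml WPbar0.2 mul1r.
have ht : \sum_e h e = \sum_e h e - (\sum_e h e) *+ #|Y|.
  rewrite {1}sum_pairs; under eq_bigr do rewrite hrow.
  rewrite sumrB sumr_const exchange_big /= -sum_pairs //.
have /eqP : (\sum_e h e) *+ #|Y| = 0.
  by rewrite -[LHS](subKr (\sum_e h e)) -ht subrr.
rewrite mulrn_eq0.
by rewrite -leqn0 leqNgt (leq_trans _ Y2) //= => /eqP.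
Qed.

Definition row_normalize (Q : {ffun Y * Y -> R}) : {ffun Y * Y -> R} :=
  [ffun e => Q e / \sum_y' Q (e.1, y')].

Lemma block_balanced_rows (Q : {ffun Y * Y -> R}) : block_balanced Q ->
  forall y, \sum_y' Q (y, y') = \sum_u Q (u, y).
Proof.
move=> bQ y; rewrite (sum_fibers kappa); under eq_bigr do rewrite bQ.
by rewrite -mulr_suml WPbar0.2 mul1r.
Qed.

(** Balance makes row sums equal column sums, so the row sums of [Q] are stationary for the
    normalised matrix. *)
Lemma row_normalize_L (Q : {ffun Y * Y -> R}) :
  F_plus E Q -> block_balanced Q -> \sum_e Q e = 1 ->
  L_family kappa E Pbar0 (row_normalize Q) /\
  is_edge_measure (row_normalize Q) Q.
Proof.
move=> FQ bQ tQ.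
have Q0 e : 0 <= Q e by apply: F_plus_ge0 FQ.
have rQ := block_balanced_rows bQ.
have rpos y : 0 < \sum_y' Q (y, y').
  have [y' yy'] : exists y', (y, y') \in E.
    apply/not_existsP => h.
    have [[WP Psum] _] := WkP0.
    have := Psum y; rewrite big1 => [/eqP|z _].
      by rewrite eq_sym oner_eq0.
    by apply: WP.1; apply/negP/h.
  by apply: lt_le_trans (FQ.2 _ yy') (pos_sum_le (f := fun z => Q (y, z)) _ _).
split.
  apply/L_familyP => //; split; first split.
  - by move=> e eE; rewrite ffunE FQ.1 // mul0r.
  - by move=> [y y'] eE; rewrite ffunE divr_gt0 // FQ.2.
  move=> y x'; under eq_bigr do rewrite ffunE /=.
  by rewrite -mulr_suml bQ -rQ mulfK // gt_eqF.
exists (fun y => \sum_y' Q (y, y')).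
  split=> [y||y']; first exact: ltW.
    by rewrite -sum_pairs.
  rewrite rQ; apply: eq_bigr => y _; rewrite ffunE /= mulrC divfK // gt_eqF //.
by move=> y y'; rewrite ffunE /= mulrC divfK // gt_eqF.
Qed.

Lemma L_row_normalize P : L_family kappa E Pbar0 P ->
  exists Q,
    [/\ F_plus E Q, block_balanced Q, \sum_e Q e = 1 & P = row_normalize Q].
Proof.
move=> LP; have [[WP _] _] := LP.
have /L_familyP := LP; case/(_ kappa_surj WPbar0) => FP bP.
have [p [[_ p1 pst] ppos]] := stationary_exists scE Y2 WP.
pose Q : {ffun Y * Y -> R} := [ffun e => p e.1 * P e].
have rowQ y : \sum_y' Q (y, y') = p y.
  by under eq_bigr do rewrite ffunE /=; rewrite -mulr_sumr WP.2 mulr1.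
exists Q; split.
- split=> [e eE|e eE]; first by rewrite ffunE FP.1 // mulr0.
  by rewrite ffunE mulr_gt0 // FP.2.
- move=> y x'; under eq_bigr do rewrite ffunE /=.
  under [in RHS]eq_bigr do rewrite ffunE /=.
  by rewrite pst -mulr_sumr bP mulrC.
- by rewrite sum_pairs; under eq_bigr do rewrite rowQ.
by apply/ffunP => -[y y']; rewrite !ffunE /= rowQ mulrAC mulfV ?mul1r // gt_eqF.
Qed.

(** The inequality ensures that the natural-number subtraction is not truncated. *)
Theorem L_m_family :
  (\sum_(e in D) #|fiber kappa e.1| <= #|E|)%N /\
  m_family E (#|E| - \sum_(e in D) #|fiber kappa e.1|) (L_family kappa E Pbar0).
Proof.
rewrite -card_block_rows; split.
  exact: (constraint_card_le block_constraints_inj).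
have [F [F0 Fm Ffree Fspan]] := constraint_kernel_basis block_constraints_inj.
have FP i : block_balanced (F i) /\ \sum_e F i e = 0.
  by apply/block_constraintsP; [exact: F0|exact: Fm].
(* The base point comes from a member of the family, the canonical embedding of [Pbar0]. *)
have [C [FC bC tC _]] :=
  L_row_normalize (canonical_embedding_L kappa_surj WkP0 WPbar0).
have domP xi : m_domain E C F xi -> F_plus E (m_point C F xi) /\
    (block_balanced (m_point C F xi) /\ \sum_e m_point C F xi e = 1).
  move=> hxi; split; first split=> // e eE.
    by rewrite ffunE FC.1 // big1 ?addr0 // => i _; rewrite F0 // mulr0.
  pose h e := \sum_i xi ord0 i * F i e.
  have mE e : m_point C F xi e = C e + h e by rewrite ffunE.
  have [hb ht] : block_balanced h /\ \sum_e h e = 0.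
    apply/block_constraintsP => [e eE|w wN].
      by rewrite /h big1 // => i _; rewrite F0 // mulr0.
    rewrite /h; under eq_bigr do rewrite mulr_suml.
    rewrite exchange_big big1 //= => i _.
    under eq_bigr do rewrite -mulrA.
    by rewrite -mulr_sumr Fm // mulr0.
  split; last by under eq_bigr do rewrite mE; rewrite big_split /= tC ht addr0.
  move=> y x'; under eq_bigr do rewrite mE.
  under [in RHS]eq_bigr do rewrite mE.
  by rewrite !big_split /= bC hb mulrDr.
exists C, F, (fun xi => row_normalize (m_point C F xi)); split.
- by split; [exact: FC.1|move=> i e; exact: F0].
- move=> a; rewrite big_ord_recl => asum apt.
  (* Weights of sum zero cancel [C], leaving a linear relation among the [F i]. *)
  have vE e : \sum_i a i * m_vertices C F i e =
      (a ord0 + \sum_i a (lift ord0 i)) * C e + \sum_i a (lift ord0 i) * F i e.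
    rewrite big_ord_recl {1}/m_vertices unlift_none mulrDl -addrA.
    congr (_ + _).
    rewrite mulr_suml -big_split; apply: eq_bigr => i _ /=.
    by rewrite /m_vertices liftK ffunE mulrDr.
  have a0 : forall i, a (lift ord0 i) = 0.
    apply: Ffree => e; have := apt e.
    by rewrite vE asum mul0r add0r.
  move=> i; case: (unliftP ord0 i) => [j ->//|->].
  by move: asum; rewrite big1 ?addr0 // => j _.
- split=> [|i]; first by rewrite sum_edges //; exact: FC.1.
  by rewrite sum_edges; [exact: (FP i).2|exact: F0].
- move=> xi /domP[FQ [bQ tQ]].
  by have [[[WP _] _] em] := row_normalize_L FQ bQ tQ.
apply/seteqP; split=> [P LP|_ [xi /domP[FQ [bQ tQ]] <-]]; last first.
  by have [] := row_normalize_L FQ bQ tQ.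
have [Q [FQ bQ tQ ->]] := L_row_normalize LP.
(* The difference of two solutions solves the homogeneous system, so its coordinates in [F] give
   [xi]. *)
pose h e := Q e - C e.
have h0 e : e \notin E -> h e = 0.
  by move=> eE; rewrite /h FQ.1 // FC.1 // subrr.
have /Fspan[a ha] : forall w, w \in N -> \sum_(e in E) h e * m e w = 0.
  apply/block_constraintsP => //; split; last by rewrite sumrB tQ tC subrr.
  by move=> y x'; rewrite !sumrB bQ bC mulrBr.
have mQ : m_point C F (\row_i a i) = Q.
  apply/ffunP => e; rewrite ffunE.
  under eq_bigr do rewrite mxE.
  case: (boolP (e \in E)) => eE; first by rewrite -ha // /h addrC subrK.
  rewrite FQ.1 // FC.1 // add0r big1 // => i _; by rewrite F0 // mulr0.
exists (\row_i a i); last by rewrite mQ.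
by move=> e eE; rewrite mQ; exact: FQ.2.
Qed.

End LumpingFibers.

(** * Exponential tilting and coboundaries on a strongly connected digraph *)

Section ExponentialTilting.
Context {R : realType} {X : finType}.
Variable D : {set X * X}.
Hypothesis scD : strongly_connected D.
Implicit Types (P : {ffun X * X -> R}) (f : X -> R) (G : X * X -> R).

(** Perron normalisation of the matrix [exp G] by its eigenvector [v] and eigenvalue [s]: the
    potential is [ln v] and the constant [ln s]. *)
Lemma tilting_exists G : (2 <= #|X|)%N ->
  exists P f c, W_space D P /\
    forall x x', (x, x') \in D -> ln (P (x, x')) = G (x, x') + f x' - f x - c.
Proof.
move=> X2.
pose A : {ffun X * X -> R} := [ffun e => if e \in D then expR (G e) else 0].
have A0 e : 0 <= A e by rewrite ffunE; case: ifP => // _; exact: expR_ge0.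
have scA : strongly_connected [set e | 0 < A e]%SET.
  have -> : [set e | 0 < A e]%SET = D; last exact: scD.
  by apply/setP => e; rewrite inE ffunE; case: ifP; rewrite ?expR_gt0 ?ltxx.
have [s [v [s0 v0 hv]]] := perron_eigenvector A0 scA X2.
pose P : {ffun X * X -> R} := [ffun e => A e * v e.2 / (s * v e.1)].
exists P, (fun x => ln (v x)), (ln s); split.
  split; first split.
  - by move=> e eD; rewrite !ffunE (negPf eD) !mul0r.
  - by move=> e eD; rewrite !ffunE eD divr_gt0 ?mulr_gt0 ?expR_gt0.
  move=> x; under eq_bigr do rewrite ffunE /=.
  by rewrite -mulr_suml (hv x : \sum_x' _ = _) mulfV // gt_eqF // mulr_gt0.
move=> x x' xx'; rewrite !ffunE xx' /= ln_div ?posrE ?mulr_gt0 ?expR_gt0 //.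
by rewrite !lnM ?posrE ?expR_gt0 // expRK; ring.
Qed.

(** Exponentiating, [exp f] is a positive eigenvector of the stochastic [P] with eigenvalue
    [exp (- c)]; hence it is constant and the eigenvalue is 1. *)
Lemma tilting_unique P P' f c : W_space D P -> W_space D P' ->
  (forall x x', (x, x') \in D ->
     ln (P' (x, x')) = ln (P (x, x')) + f x' - f x + c) ->
  P = P'.
Proof.
move=> WP WP' h.
have tilt x x' : P (x, x') * expR (f x') = expR (- c) * expR (f x) * P' (x, x').
  case: (boolP ((x, x') \in D)) => xx'; last first.
    by rewrite WP.1.1 // WP'.1.1 // mul0r mulr0.
  rewrite -[P (x, x')]lnK ?posrE ?WP.1.2 // -[P' _]lnK ?posrE ?WP'.1.2 //.
  by rewrite h // -!expRD; congr expR; ring.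
have v0 x : 0 < expR (f x) by exact: expR_gt0.
have Pv x : act P (fun x => expR (f x)) x = expR (- c) * expR (f x).
  rewrite /act; under eq_bigr do rewrite /= tilt.
  by rewrite -mulr_sumr WP'.2 mulr1.
apply/ffunP => -[x x'].
have [c1 vc] := positive_eigenvector_const scD WP v0 Pv x.
apply: (mulIf (lt0r_neq0 (v0 x'))).
by rewrite tilt c1 mul1r (vc x') mulrC.
Qed.

Lemma coboundary_inj P (l : X -> R) : (0 < #|X|)%N -> W_space D P ->
  (forall x x', (x, x') \in D -> l x' - l x + \sum_z l z = 0) ->
  forall x, l x = 0.
Proof.
move=> X0 WP h x.
have Pl z : act P l z = l z + - \sum_z l z.
  rewrite -[RHS]mul1r -(WP.2 z) mulr_suml; apply: eq_bigr => z' _.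
  case: (boolP ((z, z') \in D)) => [/h e|/WP.1.1->]; last by rewrite !mul0r.
  by congr (_ * _); lra.
have [/eqP L0 lc] := act_shift_const scD WP Pl x.
move: L0; rewrite oppr_eq0; under eq_bigr do rewrite -lc.
by rewrite sumr_const mulrn_eq0 -leqn0 leqNgt X0 /= => /eqP.
Qed.

End ExponentialTilting.

(** * The image of the canonical embedding as an e-family *)

Section CanonicalEmbedding.
Context {R : realType} {X Y : finType}.
Variables (kappa : Y -> X) (E : {set Y * Y}).
Hypothesis kappa_surj : forall x, exists y, kappa y = x.
Hypothesis scE : strongly_connected E.
Hypothesis X2 : (2 <= #|X|)%N.
Local Notation D := (lumped_edges kappa E).
Variable P0 : {ffun Y * Y -> R}.
Hypothesis WkP0 : W_kappa kappa E P0.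

(* Since edges lift through [kappa], a path from [y1] to a minimiser [t] of [f]
   on the fiber of [y1] lifts to a path from [t] that changes [f] by the same
   amount and ends in the same fiber; if [f t < f y1] its end would lie below
   the minimum. *)
Lemma potential_fiber_const (G : X * X -> R) (f : Y -> R) c :
  (forall y y', (y, y') \in E -> G (kappa y, kappa y') = f y' - f y + c) ->
  forall y1 y2, kappa y1 = kappa y2 -> f y1 = f y2.
Proof.
move=> hG.
have lift y t z : kappa t = kappa y ->
    exists2 t', kappa t' = kappa z & f z - f t' = f y - f t.
  move=> kt; apply: (connect_invariant
    (Q := fun z => exists2 t', kappa t' = kappa z & f z - f t' = f y - f t)
    _ (scE y z)); last by exists t.
  move=> u w uw [t' kt' ft'].
  have [w' kw' tw'] : exists2 w', kappa w' = kappa w & (t', w') \in E.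
    by apply: (lumped_edge_lift WkP0); rewrite kt'; apply: pairmap_lumped.
  exists w' => //; have := hG _ _ uw; have := hG _ _ tw'.
  by rewrite kt' kw' => ->; lra.
move=> y1 y2 k12.
have y2f : y2 \in fiber kappa (kappa y2) by rewrite inE.
have [t tf tmin] := argmin_exists f y2f.
have kt : kappa t = kappa y2 by move: tf; rewrite inE => /eqP.
have eqt y : kappa y = kappa y2 -> f y = f t.
  move=> ky; apply/eqP; rewrite eq_le tmin ?inE ?ky // andbT leNgt.
  apply/negP => ft; have [t' kt' ft'] := lift y t t (etrans kt (esym ky)).
  have : f t <= f t' by apply: tmin; rewrite inE kt' kt.
  by lra.
by rewrite (eqt y1) // (eqt y2).
Qed.

(** Potentials matter only up to a constant, so the total of [l] can serve as the additive constant: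
    [#|X|] parameters then describe coboundaries plus constants injectively. *)
Let m (e : X * X) (x : X) : R := (e.2 == x)%:R - (e.1 == x)%:R + 1.

Lemma sum_coboundary (l : X -> R) e :
  \sum_(x in [set: X]%SET) l x * m e x = l e.2 - l e.1 + \sum_x l x.
Proof.
have pick (z : X) : \sum_x l x * (z == x)%:R = l z.
  rewrite (bigD1 z) //= eqxx mulr1 big1 ?addr0 // => x xz.
  by rewrite eq_sym (negPf xz) mulr0.
rewrite (eq_bigl xpredT); last by move=> x; rewrite inE.
rewrite -[in RHS](pick e.2) -[in RHS](pick e.1) -sumrB -big_split.
by apply: eq_bigr => x _; rewrite /m /=; ring.
Qed.

Theorem J_e_family :
  (#|X| <= #|D|)%N /\ e_family E (#|D| - #|X|) (J_family kappa E P0).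
Proof.
have X0 : (0 < #|X|)%N by apply: leq_trans X2.
have scD := lumped_strongly_connected kappa_surj scE.
have WpP := push_W kappa_surj WkP0.
have m_inj l :
    (forall e, e \in D -> \sum_(x in [set: X]%SET) l x * m e x = 0) ->
    forall x, x \in [set: X]%SET -> l x = 0.
  move=> hl x _; apply: (coboundary_inj scD X0 WpP) => z z' zz'.
  by have := hl _ zz'; rewrite sum_coboundary.
rewrite -cardsT; split; first exact: (constraint_card_le m_inj).
have [g [g0 gfree gspan]] := constraint_complement_basis m_inj.
set d := (#|D| - _)%N in g g0 gfree gspan *.
have [Pbar /choice[f /choice[c hPbar]]] := choice (fun theta : 'rV[R]_d =>
  tilting_exists scD (fun e => \sum_i theta ord0 i * g i e) X2).
have WPbar theta := (hPbar theta).1.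
exists (fun theta => canonical_embedding kappa E P0 (Pbar theta)); split.
- apply/seteqP; split=> [_ [P WP <-]|_ [theta _ <-]]; last first.
    by exists (Pbar theta).
  (* Modulo coboundaries and constants, [ln P] is a combination of the [g i]; its coefficients are
     the parameter, and uniqueness of the tilting identifies [P]. *)
  have [a [l hal]] := gspan (fun e => ln (P e)).
  exists (\row_i a i) => //; congr canonical_embedding.
  apply: (tilting_unique scD (f := fun x => l x - f (\row_i a i) x)
    (c := c (\row_i a i) + \sum_x l x) (WPbar _) WP) => x x' xx'.
  rewrite hal // sum_coboundary (hPbar _).2 //=.
  under [in RHS]eq_bigr do rewrite mxE.
  by ring.
- move=> theta.
  by have [[]] := canonical_embedding_L kappa_surj WkP0 (WPbar theta).
(* The fixed factor of the embedding gives [K]; statistics and potential are pulled back along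
   [kappa]. *)
exists [ffun e => if e \in E
    then ln (P0 e) - ln (push kappa P0 (Defs.pairmap kappa e)) else 0],
  (fun i => [ffun e => if e \in E then g i (Defs.pairmap kappa e) else 0]),
  (fun theta y => f theta (kappa y)), c; split.
- by move=> e eE; rewrite ffunE (negPf eE).
- by move=> i e eE; rewrite ffunE (negPf eE).
- move=> a [_ [phi [k hphi]]].
  have hG y y' : (y, y') \in E ->
      \sum_i a i * g i (kappa y, kappa y') = phi y' - phi y + k.
    move=> yy'; rewrite -hphi // ffunE; apply: eq_bigr => i _.
    by rewrite ffunE yy'.
  have phic := potential_fiber_const (G := fun e => \sum_i a i * g i e) hG.
  have [sec secK] := choice kappa_surj.
  (* Being constant on fibers, [phi] descends to [X] through the section [sec]; the shift [t] makes
     the total of the descended potential equal to [k]. *)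
  pose t := (k - \sum_x phi (sec x)) / #|X|%:R.
  apply: (gfree a (fun x => phi (sec x) + t)) => _ /imsetP[[y y'] yy' ->].
  rewrite sum_coboundary /= hG //.
  rewrite (phic y (sec (kappa y))) // (phic y' (sec (kappa y'))) //.
  have tX : t *+ #|X| = k - \sum_x phi (sec x).
    by rewrite -mulr_natr divfK // pnatr_eq0 -lt0n.
  by rewrite big_split /= sumr_const tX; ring.
move=> theta y y' yy'; have eD := pairmap_lumped kappa yy'.
have [[[_ Ppos] _] _] := WkP0.
have pP := WpP.1.2 _ eD.
have -> : canonical_embedding kappa E P0 (Pbar theta) (y, y') =
    Pbar theta (kappa y, kappa y') *
    (P0 (y, y') / push kappa P0 (kappa y, kappa y')).
  by rewrite [LHS]ffunE yy'.
rewrite lnM ?ln_div ?posrE ?divr_gt0 ?(WPbar theta).1.2 ?Ppos //.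
rewrite (hPbar theta).2 // [[ffun e => if _ then _ - _ else _] _]ffunE yy'.
under [in RHS]eq_bigr do rewrite ffunE yy'.
by rewrite /Defs.pairmap /=; ring.
Qed.

End CanonicalEmbedding.

Unset Implicit Arguments.

Theorem lemma6p1 (R : realType) (X Y : finType) (kappa : Y -> X)
    (E : {set Y * Y})
    (hX : (2 <= #|X|)%N) (hY : (2 <= #|Y|)%N)
    (hE : strongly_connected E)
    (hkappa : forall x : X, exists y : Y, kappa y = x)
    (hW : (W_kappa kappa E : set {ffun Y * Y -> R}) !=set0)
    (Pbar0 : {ffun X * X -> R})
    (hPbar0 : W_space (lumped_edges kappa E) Pbar0)
    (P0 : {ffun Y * Y -> R})
    (hP0 : W_kappa kappa E P0) :
  ((#|X| <= #|lumped_edges kappa E|)%N /\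
   e_family E (#|lumped_edges kappa E| - #|X|)%N (J_family kappa E P0)) /\
  ((\sum_(e in lumped_edges kappa E) #|fiber kappa e.1| <= #|E|)%N /\
   m_family E (#|E| - \sum_(e in lumped_edges kappa E) #|fiber kappa e.1|)%N
     (L_family kappa E Pbar0)).

Proof.
split; first exact: J_e_family.
exact: (L_m_family hkappa hE hY hPbar0 hP0).
Qed.
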